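(* Let $q$ be a prime power, let $p\in\mathbb{P}^2(\overline{\mathbb{F}}_q)$ be a $q^n$-point, let $0<r<n$, and let the line $\ell=\langle p,f^r(p)\rangle$ be a $q^k$-line. Then $k\mid n$, and if $k\neq n$ then $k\mid r$.
   Context: $f=\mathrm{Frob}_q$ acts on $\mathbb{P}^2(\overline{\mathbb{F}}_q)$ by raising coordinates to the $q$th power, and correspondingly on lines. A point (respectively line) whose $f$-orbit has exactly $n$ elements is called a $q^n$-point (respectively $q^n$-line). For distinct points $p_1,p_2$, $\langle p_1,p_2\rangle$ is the unique line containing both. *)

(* Defs.v *)
From HB Require Import structures.
From mathcomp Require Import all_boot all_order all_algebra all_field.
From mathcomp Require Import classical_sets cardinality.

Set Implicit Arguments.
Unset Strict Implicit.
Unset Printing Implicit Defensive.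

Import GRing.Theory.
Local Open Scope ring_scope.

Section Plane.

Variable K : fieldType.

(* The linear subspaces of K^3 of dimension d: a point of P^2(K) is a line     *)
(* through the origin of K^3, and a line of P^2(K) is a plane through it.      *)
Record subspace (d : nat) := Subspace {
  subspace_val :> {vspace 'rV[K]_3};
  _ : \dim subspace_val == d }.

HB.instance Definition _ d := [isSub for @subspace_val d].
HB.instance Definition _ d := [Choice of subspace d by <:].

Definition point := subspace 1.
Definition line := subspace 2.

Definition incident (x : point) (l : line) : bool :=
  (subspace_val x <= subspace_val l)%VS.

Lemma homogeneous_dim (v : 'rV[K]_3) : v != 0 -> \dim <[v]>%VS == 1%N.
Proof. by move=> v0; rewrite dim_vline v0. Qed.

(* [v_0 : v_1 : v_2] *)
Definition homogeneous (v : 'rV[K]_3) (v0 : v != 0) : point :=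
  Subspace (homogeneous_dim v0).

(* The span of x and y; it is a line, hence not None, exactly when x and y     *)
(* are distinct (line_throughP).                                               *)
Definition line_through (x y : point) : option line :=
  insub (subspace_val x + subspace_val y)%VS.

Lemma subspace_dim d (U : subspace d) : \dim (subspace_val U) = d.
Proof. exact: eqP (valP U). Qed.

Lemma line_throughP (x y : point) : x != y ->
  exists2 l, line_through x y = Some l &
    forall m, incident x m && incident y m = (m == l).
Proof.
move=> xy; set W := (subspace_val x + subspace_val y)%VS.
have sxW : (subspace_val x <= W)%VS := addvSl _ _.
have dW : \dim W == 2.
  have le2 : (\dim W <= 2)%N.
    by rewrite (leq_trans (dimv_add_leqif _ _)) ?subspace_dim.
  rewrite eqn_leq le2 ltnNge; apply: contra xy => le1.
  have eqx : subspace_val x = W.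
    by apply/eqP; rewrite eqEdim sxW subspace_dim.
  rewrite eq_sym -val_eqE eqEdim !subspace_dim leqnn andbT /=.
  by rewrite eqx addvSr.
exists (Subspace dW).
  by rewrite /line_through insubT.
move=> m; rewrite /incident -subv_add -val_eqE eq_sym eqEdim /=.
by rewrite (eqP dW) subspace_dim leqnn andbT.
Qed.

End Plane.

Section Frobenius.

(* F is F_q. K is its algebraic closure when every element of K is algebraic   *)
(* over F; that hypothesis is not needed for the definitions.                  *)
Variables (F : finFieldType) (K : closedFieldType) (iota : {rmorphism F -> K}).

Let q := #|F|.

(* Frob_q acts on K^3 coordinatewise.                                          *)
Definition frob_coord (v : 'rV[K]_3) : 'rV[K]_3 := map_mx (fun x => x ^+ q) v.

(* frob_coord is only semilinear; the span of the image of a basis of U is     *)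
(* the image of U (mem_frob_span).                                             *)
Definition frob_span (U : {vspace 'rV[K]_3}) : {vspace 'rV[K]_3} :=
  <<[seq frob_coord v | v <- vbasis U]>>%VS.

Lemma q_gt0 : (0 < q)%N.
Proof. by rewrite /q (cardD1 0). Qed.

Lemma q_pchar : [pchar K].-nat q.
Proof.
have [p p_pr pF] := finPcharP F.
have pK : p \in [pchar K] by rewrite (rmorph_pchar iota pF).
have : p.-nat q by rewrite /q (card_pprimeChar pF) pnatX pnat_id.
by apply: sub_in_pnat => r _ /eqnP->.
Qed.

Lemma frob_coordD v w : frob_coord (v + w) = frob_coord v + frob_coord w.
Proof. by apply/rowP => i; rewrite !mxE exprDn_pchar // q_pchar. Qed.

Lemma frob_coordZ a v : frob_coord (a *: v) = a ^+ q *: frob_coord v.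
Proof. by apply/rowP => i; rewrite !mxE exprMn. Qed.

Lemma frob_coord0 : frob_coord 0 = 0.
Proof. by apply/rowP => i; rewrite !mxE expr0n gtn_eqF ?q_gt0. Qed.

Lemma frob_coord_eq0 v : (frob_coord v == 0) = (v == 0).
Proof.
apply/eqP/eqP => [/rowP v0 | ->]; last exact: frob_coord0.
apply/rowP => i; have /eqP := v0 i.
by rewrite !mxE expf_eq0 q_gt0 /= => /eqP.
Qed.

Lemma frob_coord_sum (I : finType) (a : I -> K) (v : I -> 'rV[K]_3) :
  frob_coord (\sum_i a i *: v i) = \sum_i a i ^+ q *: frob_coord (v i).
Proof.
elim/big_rec2: _ => [|i x y _ <-]; first exact: frob_coord0.
by rewrite frob_coordD frob_coordZ.
Qed.

Lemma qth_root (a : K) : {b | b ^+ q = a}.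
Proof.
apply: sig_eqW; have [b] := @solve_monicpoly K q (fun i => a *+ (i == 0)%N) q_gt0.
move=> bq; exists b; rewrite bq -(prednK q_gt0) big_ord_recl /= mulr1 big1 ?addr0 //=.
by move=> i _; rewrite mul0r.
Qed.

Lemma frob_coord_mem (U : {vspace _}) v : v \in U -> frob_coord v \in frob_span U.
Proof.
move=> /coord_vbasis ->; rewrite frob_coord_sum memv_suml // => i _.
by rewrite memvZ // memv_span // map_f // mem_nth // size_tuple.
Qed.

Lemma mem_frob_span (U : {vspace _}) w :
  (w \in frob_span U) <-> exists2 v, v \in U & w = frob_coord v.
Proof.
split=> [|[v vU ->]]; last exact: frob_coord_mem.
pose X := map_tuple frob_coord (vbasis U); pose b i := sval (qth_root (coord X i w)).
move/(@coord_span _ _ _ X) => ->.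
exists (\sum_i b i *: (vbasis U)`_i).
  by rewrite memv_suml // => i _; rewrite memvZ // vbasis_mem // mem_nth // size_tuple.
rewrite frob_coord_sum; apply: eq_bigr => i _.
by rewrite (svalP (qth_root _)) (nth_map 0) // size_tuple.
Qed.

Lemma frob_span_dim d (U : subspace K d) : \dim (frob_span U) == d.
Proof.
rewrite -[X in _ == X](subspace_dim U); apply/eqP.
suff /eqP: free (map_tuple frob_coord (vbasis U)) by rewrite size_tuple.
apply/freeP => a /= a0 i.
pose b j := sval (qth_root (a j)).
have bE j : b j ^+ q = a j := svalP (qth_root (a j)).
have : frob_coord (\sum_j b j *: (vbasis U)`_j) == 0.
  apply/eqP; rewrite frob_coord_sum -[RHS]a0; apply: eq_bigr => j _.
  by rewrite bE (nth_map 0) // size_tuple.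
rewrite frob_coord_eq0 => /eqP b0.
have /freeP/(_ b b0 i) bi0 := basis_free (vbasisP U).
by rewrite -bE bi0 expr0n gtn_eqF ?q_gt0.
Qed.

Definition frob d (U : subspace K d) : subspace K d :=
  Subspace (frob_span_dim U).

Lemma frob_homogeneous (v : 'rV[K]_3) (v0 : v != 0) (fv0 : frob_coord v != 0) :
  frob (homogeneous v0) = homogeneous fv0.
Proof.
apply/val_inj/esym/eqP; rewrite /= eqEdim dim_vline fv0.
rewrite -memvE frob_coord_mem ?memv_line //=.
by have := frob_span_dim (homogeneous v0) => /= /eqP ->.
Qed.

End Frobenius.

Arguments frob {F K} iota {d} U.

(* The f-orbit of x has exactly n elements. If f is bijective, as frob is, a   *)
(* finite forward orbit is also the full orbit under the powers of f.          *)
Definition orbit_size (T : Type) (f : T -> T) (x : T) (n : nat) : Prop :=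
  (range (fun i => iter i f x) #= `I_n)%card.

(* Main.v *)
From mathcomp Require Import boolp classical_sets cardinality.
Require Import Defs.
From mathcomp Require Import all_boot all_order all_algebra all_field.

(* Write f for Frobenius and l = <p, f^r p>. Since f^n fixes p and f^r p, it
   fixes l, so k divides n. If k < n then p and f^k p are distinct points of
   l = f^k l, hence f^r p and f^(r+k) p are distinct points of f^r l; both also
   lie on l = f^k l, so f^r l = l and k divides r. *)

Lemma iter_inj (T : Type) (f : T -> T) (i : nat) :
  injective f -> injective (iter i f).
Proof. by move=> f_inj; elim: i => // i IHi y z /f_inj /IHi. Qed.

Lemma orbit_size_iter (T : eqType) (f : T -> T) (x : T) (n i : nat) :
  injective f -> orbit_size f x n -> (iter i f x == x) = (n %| i).
Proof.
move=> f_inj xn; pose g j := iter j f x.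
have g_inj (A : nat -> Prop) :
    (forall b, A b -> forall d, 0 < d <= b -> g d != x) ->
    forall a b, A a -> A b -> g a = g b -> a = b.
  move=> no_per; suff lt_inj a b : A b -> a < b -> g a <> g b.
    move=> a b Aa Ab eqg; case: (ltngtP a b) => // [/lt_inj|/lt_inj].
      by move/(_ Ab).
    by move/(_ Aa)/(_ (esym eqg)).
  move=> Ab lt_ab eqg; have dP : 0 < b - a <= b by rewrite subn_gt0 lt_ab leq_subr.
  case/eqP: (no_per b Ab _ dP).
  move: eqg; rewrite /g -{1}(subnKC (ltnW lt_ab)) iterD => /esym.
  by move/(iter_inj _ _ _ f_inj).
have ex_per : exists m, (0 < m) && (g m == x).
  apply: contrapT => no_per; apply: infinite_nat.
  have gI : {in [set: nat]%classic &, injective g}.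
    move=> a b _ _; apply: (g_inj (fun=> True)) => // c _ d /andP[d_gt0 _].
    by apply/negP => gd; apply: no_per; exists d; rewrite d_gt0.
  by rewrite -(eq_finite_set (inj_card_eq gI)); exists n.
case: (ex_minnP ex_per) => m /andP[m_gt0 /eqP gm] min_m.
have g_mod j : g j = g (j %% m).
  rewrite /g {1}(divn_eq j m) addnC iterD; congr (iter _ f _).
  by elim: (j %/ m) => // a IHa; rewrite mulSn iterD IHa.
have -> : n = m.
  have gI : {in `I_m &, injective g}.
    move=> a b /set_mem am /set_mem bm.
    apply: (g_inj (fun c => c < m)) am bm => c lt_cm d.
    case/andP=> d_gt0 le_dc; apply/negP => gd; have := min_m d.
    by rewrite d_gt0 gd leqNgt (leq_ltn_trans le_dc lt_cm) => /(_ isT).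
  have rg : range g = (g @` `I_m)%classic.
    apply/seteqP; split=> y [j _ <-]; last by exists j.
    by exists (j %% m); rewrite /= ?ltn_mod // -g_mod.
  apply/card_eq_II/(card_esym (card_eq_trans (card_esym (inj_card_eq gI)) _)).
  by rewrite -rg.
apply/eqP/idP => [gi|/eqP mi]; last by rewrite -[LHS]/(g i) g_mod mi.
rewrite /dvdn; case: posnP => // im_gt0.
have := min_m (i %% m); rewrite im_gt0 -g_mod /g gi eqxx.
by move/(_ isT); rewrite leqNgt ltn_mod m_gt0.
Qed.

Section Frobenius.

Local Open Scope ring_scope.

Variables (F : finFieldType) (K : closedFieldType) (iota : {rmorphism F -> K}).

Lemma frob_coord_inj : injective (@frob_coord F K).
Proof.
move=> v w vw; apply/eqP; rewrite -GRing.subr_eq0 -(frob_coord_eq0 F).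
have := frob_coordD iota (v - w) w; rewrite GRing.subrK vw.
by rewrite -[LHS]GRing.add0r => /GRing.addIr <-.
Qed.

Lemma frob_spanS (U V : {vspace 'rV[K]_3}) :
  (frob_span F U <= frob_span F V)%VS = (U <= V)%VS.
Proof.
apply/subvP/subvP => UV v; last first.
  by case/(mem_frob_span iota) => w /UV wV ->; apply: (frob_coord_mem iota).
move=> /(frob_coord_mem iota) /UV /(mem_frob_span iota)[w wV].
by move/frob_coord_inj->.
Qed.

Lemma frob_inj d : injective (@frob F K iota d).
Proof.
move=> U V /(congr1 (@subspace_val K d)) /= eqUV.
by apply/val_inj/eqP; rewrite eqEsubv -frob_spanS -[X in _ && X]frob_spanS eqUV subvv.
Qed.

Lemma incident_iter_frob i (x : point K) (l : line K) :
  incident (iter i (frob iota) x) (iter i (frob iota) l) = incident x l.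
Proof. by elim: i => //= i <-; apply: frob_spanS. Qed.

End Frobenius.

Theorem lemma4p3 (F : finFieldType) (K : closedFieldType)
    (iota : {rmorphism F -> K}) (Kalg : forall z : K, algebraicOver iota z)
    (n r k : nat) (p : point K) (l : line K)
    (hp : orbit_size (frob iota) p n)
    (r_gt0 : 0 < r) (r_lt_n : r < n)
    (hl : line_through p (iter r (frob iota) p) = Some l)
    (hk : orbit_size (frob iota) l k) :
  k %| n /\ (k <> n -> k %| r).
Proof.
pose f d := @frob F K iota d.
have per_p i : (iter i (f 1) p == p) = (n %| i).
  exact: orbit_size_iter (@frob_inj _ _ _ _) hp.
have per_l i : (iter i (f 2) l == l) = (k %| i).
  exact: orbit_size_iter (@frob_inj _ _ _ _) hk.
have unique_line (x y : point K) (m m' : line K) : x != y ->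
    incident x m -> incident y m -> incident x m' -> incident y m' -> m = m'.
  move=> /line_throughP[l0 _ l0P] xm ym xm' ym'.
  by transitivity l0; [|symmetry]; apply/eqP; rewrite -l0P ?xm ?ym ?xm' ?ym'.
have p_neq i : 0 < i < n -> p != iter i (f 1) p.
  by case/andP=> i_gt0 lt_in; rewrite eq_sym per_p gtnNdvd.
have [pl rl] : incident p l /\ incident (iter r (f 1) p) l.
  have [|l0] := @line_throughP _ p (iter r (f 1) p); first by rewrite p_neq ?r_gt0.
  by rewrite hl => -[<-] /(_ l); rewrite eqxx => /andP.
have k_dvd_n : k %| n.
  have fnp : iter n (f 1) p = p by apply/eqP; rewrite per_p.
  rewrite -per_l; apply/eqP.
  apply: (unique_line p (iter r (f 1) p)) => //; first by rewrite p_neq ?r_gt0.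
    by rewrite -{1}fnp incident_iter_frob.
  by rewrite -{1}fnp -iterD addnC iterD incident_iter_frob.
split=> // /eqP k_neq_n.
have n_gt0 : 0 < n by apply: leq_trans r_lt_n.
have k_range : 0 < k < n.
  by rewrite (dvdn_gt0 n_gt0) // ltn_neqAle k_neq_n dvdn_leq.
have fkl : iter k (f 2) l = l by apply/eqP; rewrite per_l.
rewrite -per_l; apply/eqP.
apply: (unique_line (iter r (f 1) p) (iter r (f 1) (iter k (f 1) p))) => //.
- by rewrite (inj_eq (iter_inj _ _ _ (@frob_inj _ _ _ _))) p_neq.
- by rewrite incident_iter_frob.
- by rewrite incident_iter_frob -fkl incident_iter_frob.
- by rewrite -iterD addnC iterD -fkl incident_iter_frob.
Qed.
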